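(* Let $(\alpha_0,\alpha_1,\alpha_2,\alpha_3)$ be a rotation quadrangle (in the generic sense described in the context), with relative revolute axes $r_{01}, r_{12}, r_{23}, r_{30}$ in the moving space, and let $u$ and $v$ be the two transversals of these four axes. Then the locus of oriented planes $\varepsilon$ in the moving space whose homologous images $\alpha_0(\varepsilon),\alpha_1(\varepsilon),\alpha_2(\varepsilon),\alpha_3(\varepsilon)$ are tangent to (in oriented contact with) a cone of revolution consists of six pencils of parallel planes: (1) the planes orthogonal to one of the four revolute axes $r_{01}$, $r_{12}$, $r_{23}$, $r_{30}$, and (2) the planes orthogonal to one of the two transversals $u$ or $v$ of these axes.
   Context: A displacement is a proper (orientation-preserving) Euclidean motion of three-space, viewed as a map $\alpha$ from a moving space to a fixed space, both copies of Euclidean three-space. Indices are taken modulo four. For four displacements $\alpha_0,\alpha_1,\alpha_2,\alpha_3$ the relative displacements of consecutive positions are $\tau_{i,i+1}=\alpha_{i+1}\circ\alpha_i^{-1}$. The quadruple $(\alpha_0,\alpha_1,\alpha_2,\alpha_3)$ is called a rotation quadrangle (or rotation quadrilateral) if each of $\tau_{01},\tau_{12},\tau_{23},\tau_{30}$ is a pure rotation (about some line). The relative revolute axis $r_{i,i+1}$ in the moving space is the line of points $X$ with $\alpha_i(X)=\alpha_{i+1}(X)$; equivalently, $\alpha_i(r_{i,i+1})=\alpha_{i+1}(r_{i,i+1})$ is the axis of $\tau_{i,i+1}$. The homologous images of an oriented plane $\varepsilon$ are the oriented planes $\varepsilon_i=\alpha_i(\varepsilon)$, $i=0,1,2,3$.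 Planes are oriented (carry a chosen unit normal), and tangency to a cone of revolution means oriented contact: the cone axis is the intersection line of the unique bisector planes of the oriented planes $\varepsilon_i$ and $\varepsilon_{i+1}$. In terms of equations: the four planes $\varepsilon_0,\dots,\varepsilon_3$ have a point in common and their oriented normal vectors $\mathbf{n}_0,\dots,\mathbf{n}_3$ (all of the same length) are position vectors of four points on a circle; configurations where $\mathbf{n}_0,\dots,\mathbf{n}_3$ span only a two-dimensional subspace (so that all four planes are parallel to a fixed direction) do not qualify as solutions. Standing genericity assumptions: Study's kinematic mapping represents a displacement by a unit dual quaternion $x+\epsilon y$ up to nonzero real scalar factor, i.e. by a point $[x_0:\dots:x_3:y_0:\dots:y_3]$ of the Study quadric $\mathcal{S}=\{x_0y_0+x_1y_1+x_2y_2+x_3y_3=0\}$ in real projective space $P^7$ (with $x\neq 0$). Let $A_i\in\mathcal{S}$ be the image of $\alpha_i$. It is assumed throughout that the quadrilateral $A_0A_1A_2A_3$ spans a three-dimensional projective subspace that is not completely contained in $\mathcal{S}$. A transversal of the four axes is a line meeting all four of them; the configuration is taken to be generic, so that the four axes have precisely two transversals, denoted $u$ and $v$.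
   Formalization: The locus is shown to be the planes of the six pencils whose four homologous normals span three-space; it equals the six pencils in full when every pencil has this property, which the stated genericity does not force. *)

(* Defs.v *)
From HB Require Import structures.
From mathcomp Require Import all_boot all_order all_algebra.
From mathcomp Require Import boolp classical_sets reals.
Set Implicit Arguments.
Unset Strict Implicit.
Unset Printing Implicit Defensive.
Import Order.TTheory GRing.Theory Num.Theory.
Local Open Scope classical_set_scope.
Local Open Scope ring_scope.

(* Points and vectors of Euclidean three-space are row vectors 'rV[R]_3, and
   matrices act on the right.  Cyclic indices live in 'Z_4, where i + 1 is the
   successor modulo four. *)

Section Euclidean.
Variable R : realType.

Definition dot n (u v : 'rV[R]_n) : R := (u *m v^T) 0 0.

(* The indices k + 1 and k + 2 are taken modulo three. *)
Definition cross (u v : 'rV[R]_3) : 'rV[R]_3 :=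
  \row_(k < 3) (u 0 (k + 1) * v 0 (k + 2) - u 0 (k + 2) * v 0 (k + 1)).

Record displacement := Displacement {
  drot : 'M[R]_3;
  dtrans : 'rV[R]_3;
  drotP : drot *m drot^T = 1%:M /\ \det drot = 1
}.

Definition dapp (a : displacement) (x : 'rV[R]_3) : 'rV[R]_3 :=
  x *m drot a + dtrans a.
Coercion dapp : displacement >-> Funclass.

Lemma dcomp_subproof (b a : displacement) :
  (drot a *m drot b) *m (drot a *m drot b)^T = 1%:M /\
  \det (drot a *m drot b) = 1.
Proof.
case: a b => [A s [AA dA]] [B t [BB dB]] /=; split.
  by rewrite trmx_mul mulmxA -(mulmxA A) BB mulmx1.
by rewrite det_mulmx dA dB mulr1.
Qed.

Definition dcomp (b a : displacement) : displacement :=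
  @Displacement (drot a *m drot b) (dtrans a *m drot b + dtrans b) (dcomp_subproof b a).

Lemma dinv_subproof (a : displacement) :
  (drot a)^T *m ((drot a)^T)^T = 1%:M /\ \det (drot a)^T = 1.
Proof. by case: a => [A s [AA dA]] /=; rewrite trmxK det_tr (mulmx1C AA). Qed.

Definition dinv (a : displacement) : displacement :=
  @Displacement (drot a)^T (- (dtrans a *m (drot a)^T)) (dinv_subproof a).

Lemma dcompE (b a : displacement) x : dcomp b a x = b (a x).
Proof. by rewrite /dapp /= mulmxDl -mulmxA addrA. Qed.

Lemma dinvK (a : displacement) : cancel a (dinv a).
Proof.
move=> x; rewrite /dapp /= mulmxDl -mulmxA.
by case: (drotP a) => -> _; rewrite mulmx1 addrK.
Qed.

Record line := Line {
  lpt : 'rV[R]_3;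
  ldir : 'rV[R]_3;
  ldir_neq0 : ldir != 0
}.

Definition lpoints (l : line) : set 'rV[R]_3 :=
  [set x | exists s : R, x = lpt l + s *: ldir l].

Definition meets (l m : line) : Prop := lpoints l `&` lpoints m !=set0.

Definition transversal (r : 'Z_4 -> line) (l : line) : Prop :=
  forall i, meets l (r i).

Definition precisely_two_transversals (r : 'Z_4 -> line) (u v : line) : Prop :=
  lpoints u <> lpoints v /\
  forall l, transversal r l <-> (lpoints l = lpoints u \/ lpoints l = lpoints v).

Definition rotation_about (t : displacement) (l : line) : Prop :=
  (forall x, lpoints l x -> t x = x) /\ exists y, t y <> y.

Definition pure_rotation (t : displacement) : Prop :=
  exists l, rotation_about t l.

Definition relative_displacement (a : 'Z_4 -> displacement) (i : 'Z_4) :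
  displacement := dcomp (a (i + 1)) (dinv (a i)).

Definition rotation_quadrangle (a : 'Z_4 -> displacement) : Prop :=
  forall i, pure_rotation (relative_displacement a i).

Definition relative_revolute_axis (a : 'Z_4 -> displacement) (i : 'Z_4)
    (l : line) : Prop :=
  lpoints l = [set x | a i x = a (i + 1) x].

(* Quaternions are rows (q0, q1, q2, q3) with scalar part q0, and a dual
   quaternion x + eps y is the row (x0, ..., x3, y0, ..., y3). *)

Definition quat (s : R) (w : 'rV[R]_3) : 'rV[R]_4 := row_mx (s%:M : 'rV_1) w.
Definition qre (q : 'rV[R]_4) : R := q 0 0.
Definition qim (q : 'rV[R]_4) : 'rV[R]_3 := rsubmx (q : 'rV[R]_(1 + 3)).

Definition qmul (p q : 'rV[R]_4) : 'rV[R]_4 :=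
  quat (qre p * qre q - dot (qim p) (qim q))
       (qre p *: qim q + qre q *: qim p + cross (qim p) (qim q)).

Definition qconj (q : 'rV[R]_4) : 'rV[R]_4 := quat (qre q) (- qim q).

Definition primal (q : 'rV[R]_(4 + 4)) : 'rV[R]_4 := lsubmx q.
Definition dual (q : 'rV[R]_(4 + 4)) : 'rV[R]_4 := rsubmx q.

Definition dqmul (p q : 'rV[R]_(4 + 4)) : 'rV[R]_(4 + 4) :=
  row_mx (qmul (primal p) (primal q))
         (qmul (primal p) (dual q) + qmul (dual p) (primal q)).

(* Conjugation of both the quaternion units and eps. *)
Definition dqconj (q : 'rV[R]_(4 + 4)) : 'rV[R]_(4 + 4) :=
  row_mx (qconj (primal q)) (- qconj (dual q)).

Definition dqpoint (p : 'rV[R]_3) : 'rV[R]_(4 + 4) :=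
  row_mx (quat 1 0) (quat 0 p).

Definition study_form (q : 'rV[R]_(4 + 4)) : R := dot (primal q) (dual q).

(* q is a homogeneous coordinate vector of the image of a under Study's
   kinematic mapping.  After scaling q to a unit dual quaternion, a acts on
   points by p |-> q p q^*; the factor |x|^2 makes the condition independent of
   the choice of a representative of [q]. *)
Definition study_image (q : 'rV[R]_(4 + 4)) (a : displacement) : Prop :=
  [/\ study_form q = 0, primal q != 0 &
   forall p, dqmul (dqmul q (dqpoint p)) (dqconj q)
             = dot (primal q) (primal q) *: dqpoint (a p)].

(* The points [A i] span a projective three-space, not contained in the Study
   quadric. *)
Definition study_generic (A : 'Z_4 -> 'rV[R]_(4 + 4)) : Prop :=
  row_free (\matrix_(i < 4) A i) /\
  exists c : 'rV[R]_4, study_form (c *m \matrix_(i < 4) A i) != 0.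

(* The oriented plane { x | onormal . x = ooffset }, oriented by its unit
   normal. *)
Record oplane := OPlane {
  onormal : 'rV[R]_3;
  ooffset : R;
  onormal_unit : dot onormal onormal = 1
}.

Definition opoints (e : oplane) : set 'rV[R]_3 :=
  [set x | dot (onormal e) x = ooffset e].

Lemma dot_drot (a : displacement) x y :
  dot (x *m drot a) (y *m drot a) = dot x y.
Proof.
rewrite /dot trmx_mul mulmxA -(mulmxA x).
by case: (drotP a) => -> _; rewrite mulmx1.
Qed.

Lemma oimage_subproof (a : displacement) (e : oplane) :
  dot (onormal e *m drot a) (onormal e *m drot a) = 1.
Proof. by rewrite dot_drot onormal_unit. Qed.

Definition oimage (a : displacement) (e : oplane) : oplane :=
  @OPlane (onormal e *m drot a)
          (ooffset e + dot (onormal e *m drot a) (dtrans a))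
          (oimage_subproof a e).

Lemma opoints_oimage (a : displacement) (e : oplane) x :
  opoints (oimage a e) (a x) <-> opoints e x.
Proof.
rewrite /opoints /oimage /dapp /=.
have -> : dot (onormal e *m drot a) (x *m drot a + dtrans a) =
    dot (onormal e) x + dot (onormal e *m drot a) (dtrans a).
  by rewrite -(dot_drot a (onormal e) x) /dot linearD /= mulmxDr mxE.
by split=> [/addIr|->].
Qed.

Definition concyclic (p : 'Z_4 -> 'rV[R]_3) : Prop :=
  exists (m a : 'rV[R]_3) (rho : R), [/\ a != 0, 0 < rho &
    forall i, dot a (p i - m) = 0 /\ dot (p i - m) (p i - m) = rho ^+ 2].

Definition normals_span (e : 'Z_4 -> oplane) : Prop :=
  \rank (\matrix_(i < 4) onormal (e i)) = 3.

(* Oriented contact of four planes with a cone of revolution: the common point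
   is the apex, and the axis is normal to the plane of the circle that carries
   the unit normals.  Four planes parallel to a fixed direction do not
   qualify. *)
Definition tangent_to_cone (e : 'Z_4 -> oplane) : Prop :=
  [/\ exists x, forall i, opoints (e i) x,
      concyclic (fun i => onormal (e i)) &
      normals_span e].

Definition homologous (a : 'Z_4 -> displacement) (e : oplane) : 'Z_4 -> oplane :=
  fun i => oimage (a i) e.

Definition cone_locus (a : 'Z_4 -> displacement) : set oplane :=
  [set e | tangent_to_cone (homologous a e)].

(* The oriented planes orthogonal to l, with either orientation. *)
Definition orthogonal_pencil (l : line) : set oplane :=
  [set e | exists c : R, onormal e = c *: ldir l].

Definition six_pencils (r : 'Z_4 -> line) (u v : line) : set oplane :=
  (\bigcup_i orthogonal_pencil (r i)) `|`
  (orthogonal_pencil u `|` orthogonal_pencil v).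

(* The planes whose homologous images are not all parallel to a fixed
   direction. *)
Definition qualifying (a : 'Z_4 -> displacement) : set oplane :=
  [set e | normals_span (homologous a e)].

End Euclidean.

(* Main.v *)
Require Import Defs.
From mathcomp Require Import all_boot all_order all_algebra.
From mathcomp Require Import boolp classical_sets reals.
From mathcomp Require Import ring lra.
Set Implicit Arguments.
Unset Strict Implicit.
Unset Printing Implicit Defensive.
Import Order.TTheory GRing.Theory Num.Theory.
Local Open Scope classical_set_scope.
Local Open Scope ring_scope.

(** Write n for the unit normal of the plane and n_i for its images.  When the
    n_i span space, they satisfy a single linear relation sum w_i n_i = 0, and
    solving linear systems by orthogonality to w shows that the images touch a
    cone as soon as sum w_i = 0 (the n_i lie in a plane off the origin, hence on
    a circle of the unit sphere) and sum w_i d_i = 0 for the offsets d_i (the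
    planes share a point); this is [cone_of_relation].

    The six pencils satisfy these conditions.  If n is parallel to the axis
    r_(i,i+1), then the i-th and (i+1)-st images coincide, and w is the
    difference of two indicators ([revolute_cone]).  If n is parallel to a
    transversal, which meets the axes in points X_i = p + s_i n, then the common
    images P_i = alpha_i (X_i) = alpha_(i+1) (X_i) form a closed quadrilateral
    whose sides are (s_i - s_(i-1)) n_i; so w_i = s_i - s_(i-1) works, all three
    sums being telescoping ([transversal_cone]).  This w is not zero because the
    axes are not concurrent: otherwise they would have infinitely many
    transversals.

    Conversely, suppose that the images touch a cone and that n is parallel to
    no axis.  A point Q of the cone axis has the same signed distance from all
    four image planes, so the points M_i = alpha_i^-1 (Q) lie in one plane
    orthogonal to n.  As alpha_(i+1)^-1 alpha_i is a rotation about r_(i,i+1),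
    M_(i+1) is the mirror image of M_i in the plane B_i through r_(i,i+1) that is
    parallel to n ([reflect_pullback]).  Projecting along n, four successive line
    reflections fix the projection of M_0; letting Q run through the cone axis,
    they fix two points, so their product, a direct isometry, is the identity.
    Therefore the four lines are concurrent or parallel ([four_reflections]).  In
    the first case, the B_i share a line with direction n; it meets all axes, so
    it is one of the two transversals.  In the second case, the axes are all
    orthogonal to one vector K.  If they were not all at the same height over
    K, the line halfway between the transversals u and v would be a third
    transversal ([two_transversals_level]); so they lie in one plane, the B_i
    coincide, and the first case applies again. *)

(** * Scalar and vector products *)

Section Dot.
Variables (R : realType) (n : nat).
Implicit Types (u v w : 'rV[R]_n) (c : R).

Lemma dotE u v : dot u v = \sum_j u 0 j * v 0 j.
Proof. by rewrite /dot mxE; apply: eq_bigr => j _; rewrite mxE. Qed.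

Lemma dotC u v : dot u v = dot v u.
Proof. by rewrite !dotE; apply: eq_bigr => j _; rewrite mulrC. Qed.

Lemma dotDl u v w : dot (u + v) w = dot u w + dot v w.
Proof. by rewrite /dot mulmxDl mxE. Qed.

Lemma dotNl u w : dot (- u) w = - dot u w.
Proof. by rewrite /dot mulNmx mxE. Qed.

Lemma dotZl c u w : dot (c *: u) w = c * dot u w.
Proof. by rewrite /dot -scalemxAl mxE. Qed.

Lemma dotDr u v w : dot w (u + v) = dot w u + dot w v.
Proof. by rewrite !(dotC w) dotDl. Qed.

Lemma dotNr u w : dot w (- u) = - dot w u.
Proof. by rewrite !(dotC w) dotNl. Qed.

Lemma dotZr c u w : dot w (c *: u) = c * dot w u.
Proof. by rewrite !(dotC w) dotZl. Qed.

Lemma dot0l w : dot 0 w = 0.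
Proof. by rewrite /dot mul0mx mxE. Qed.

Lemma dot_ge0 u : 0 <= dot u u.
Proof. by rewrite dotE sumr_ge0 // => j _; rewrite -expr2 sqr_ge0. Qed.

Lemma dot_eq0 u : (dot u u == 0) = (u == 0).
Proof.
apply/idP/eqP => [|->]; last by rewrite dot0l.
rewrite dotE psumr_eq0 => [/allP u0|j _]; last by rewrite -expr2 sqr_ge0.
apply/rowP => j; rewrite mxE; apply/eqP.
by have := u0 j (mem_index_enum j); rewrite /= mulf_eq0 orbb.
Qed.
End Dot.

Definition dot_linear := (dotDl, dotDr, dotNl, dotNr, dotZl, dotZr).

Section Space.
Variable R : realType.
Implicit Types (u v w k n d : 'rV[R]_3).

Lemma dot3E u v : dot u v = u 0 0 * v 0 0 + u 0 1 * v 0 1 + u 0 2 * v 0 2.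
Proof.
rewrite dotE !big_ord_recl big_ord0 addr0 addrA.
by congr (_ * _ + _ * _ + _ * _); congr (_ 0 _); apply/val_inj.
Qed.

Lemma row3P u v :
  u 0 0 = v 0 0 -> u 0 1 = v 0 1 -> u 0 2 = v 0 2 -> u = v.
Proof.
move=> e0 e1 e2; apply/rowP => -[[|[|[|//]]] ij].
- by rewrite (_ : Ordinal ij = 0) //; apply/val_inj.
- by rewrite (_ : Ordinal ij = 1) //; apply/val_inj.
- by rewrite (_ : Ordinal ij = 2) //; apply/val_inj.
Qed.

Lemma rowD u v j : (u + v) 0 j = u 0 j + v 0 j.
Proof. by rewrite mxE. Qed.
Lemma rowN u j : (- u) 0 j = - u 0 j.
Proof. by rewrite mxE. Qed.
Lemma rowZ c u j : (c *: u) 0 j = c * u 0 j.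
Proof. by rewrite mxE. Qed.
Definition rowE := (rowD, rowN, rowZ).

Lemma cross3E u v :
  [/\ cross u v 0 0 = u 0 1 * v 0 2 - u 0 2 * v 0 1,
      cross u v 0 1 = u 0 2 * v 0 0 - u 0 0 * v 0 2 &
      cross u v 0 2 = u 0 0 * v 0 1 - u 0 1 * v 0 0].
Proof.
split; rewrite mxE.
- by congr (_ * _ - _ * _); congr (_ 0 _); apply/val_inj.
- by congr (_ * _ - _ * _); congr (_ 0 _); apply/val_inj.
- by congr (_ * _ - _ * _); congr (_ 0 _); apply/val_inj.
Qed.

Lemma cross0 u : cross u 0 = 0.
Proof.
case: (cross3E u 0) => E0 E1 E2.
by apply: row3P; rewrite !(E0, E1, E2) !mxE; ring.
Qed.

Lemma dot_crossl u v : dot (cross u v) u = 0.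
Proof. by rewrite dot3E; case: (cross3E u v) => -> -> ->; ring. Qed.

Lemma dot_crossr u v : dot (cross u v) v = 0.
Proof. by rewrite dot3E; case: (cross3E u v) => -> -> ->; ring. Qed.

Lemma cross_cross u v w :
  cross u (cross v w) = dot u w *: v - dot u v *: w.
Proof.
case: (cross3E u (cross v w)) (cross3E v w) => E0 E1 E2 [F0 F1 F2].
by apply: row3P; rewrite !(E0, E1, E2) !(F0, F1, F2) !rowE !dot3E; ring.
Qed.

Lemma dot_cross_cross u v : dot (cross u v) (cross u v) =
  dot u u * dot v v - dot u v ^+ 2.
Proof. by rewrite !dot3E; case: (cross3E u v) => -> -> ->; ring. Qed.

(** The normalized cross product of n and d; the last clause expresses that the
    orthogonal complement of two independent vectors is a line. *)
Lemma unit_common_normal n d : dot n n = 1 ->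
  (forall c, n != c *: d) -> d != 0 ->
  exists k, [/\ dot k k = 1, dot k n = 0, dot k d = 0 &
    forall x, dot x n = 0 -> dot x d = 0 -> x = dot x k *: k].
Proof.
move=> n1 nd d0; pose w := cross n d.
have w0 : dot w w != 0.
  apply/eqP => /eqP; rewrite dot_eq0 => /eqP w0.
  have := cross_cross d n d; rewrite -/w w0 cross0.
  move/esym/eqP; rewrite subr_eq0 => /eqP E.
  have dd0 : dot d d != 0 by rewrite dot_eq0.
  case/negP: (nd (dot d n / dot d d)); apply/eqP.
  by rewrite mulrC -scalerA -E scalerA mulVf // scale1r.
pose s := Num.sqrt (dot w w).
have s2 : s ^+ 2 = dot w w by rewrite sqr_sqrtr // dot_ge0.
have s0 : s != 0 by rewrite -sqrf_eq0 s2.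
exists (s^-1 *: w); split.
- by rewrite dotZl dotZr -s2; field.
- by rewrite dotZl dot_crossl mulr0.
- by rewrite dotZl dot_crossr mulr0.
move=> x xn xd; have := cross_cross w x w.
have -> : cross x w = 0.
  by rewrite cross_cross xn xd !scale0r subr0.
rewrite cross0.
move/esym/eqP; rewrite subr_eq0 => /eqP E.
rewrite dotZr scalerA mulrAC -scalerA dotC -E scalerA -s2 -expr2 exprVn.
by rewrite mulVf ?scale1r // sqrf_eq0.
Qed.

(** The vectors k and n x k form an orthonormal basis of the plane orthogonal to
    n, in which the planar arguments below are carried out. *)
Lemma planar_coordinates n k : dot n n = 1 -> dot k k = 1 -> dot k n = 0 ->
  forall x, dot x n = 0 ->
  x = dot x k *: k + dot x (cross n k) *: cross n k.
Proof.
move=> n1 k1 kn x xn.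
have nk : dot n k = 0 by rewrite dotC.
(* The residue y is orthogonal to the orthonormal frame n, k, n x k. *)
pose y := x - dot x k *: k - dot x (cross n k) *: cross n k.
have w1 : dot (cross n k) (cross n k) = 1.
  by rewrite dot_cross_cross n1 k1 nk; ring.
have yk : dot y k = 0.
  by rewrite !dot_linear k1 dot_crossr; ring.
have yn : dot y n = 0.
  by rewrite !dot_linear xn kn dot_crossl; ring.
have yw : dot y (cross n k) = 0.
  by rewrite !dot_linear w1 (dotC k) dot_crossr; ring.
have := cross_cross y n k; rewrite yk yn !scale0r subr0 => c0.
have := dot_cross_cross y (cross n k); rewrite c0 dot0l w1 yw mulr1.
rewrite expr0n subr0 => /esym/eqP; rewrite dot_eq0 /y -addrA -opprD subr_eq0.
by move/eqP.
Qed.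

End Space.

(** * Products of line reflections in the plane *)

Section PlaneReflections.
Variable F : realFieldType.
Implicit Types (k z c : F * F) (h : F).

Definition pdot k z := k.1 * z.1 + k.2 * z.2.
Definition pdet k z := k.1 * z.2 - k.2 * z.1.

Definition reflect_in k h z : F * F :=
  (z.1 - 2 * (pdot k z - h) * k.1, z.2 - 2 * (pdot k z - h) * k.2).

Lemma reflect_inK k h : pdot k k = 1 -> involutive (reflect_in k h).
Proof.
case: k => a b; rewrite /pdot /= => k1 [x y].
have a2 : a ^+ 2 = 1 - b ^+ 2 by rewrite -k1; ring.
by rewrite /reflect_in /pdot /=; congr pair; ring: a2.
Qed.

(** Complex notation for a rotation: for unit vectors k0 and k1, this is the square
    of the complex number k1 / k0. *)
Definition double_angle k0 k1 : F * F :=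
  (1 - 2 * pdet k0 k1 ^+ 2, 2 * pdot k0 k1 * pdet k0 k1).

(** Multiplication of complex numbers. *)
Definition cmul (w z : F * F) : F * F :=
  (w.1 * z.1 - w.2 * z.2, w.2 * z.1 + w.1 * z.2).

(** Reflections in two lines compose to a rotation through twice the angle between
    their normals, followed by a translation. *)
Lemma reflect2E k0 k1 h0 h1 z : pdot k0 k0 = 1 -> pdot k1 k1 = 1 ->
  reflect_in k1 h1 (reflect_in k0 h0 z) =
  cmul (double_angle k0 k1) z + reflect_in k1 h1 (reflect_in k0 h0 0).
Proof.
case: k0 k1 z => [a b] [a' b'] [x y]; rewrite /pdot /= => k0 k1.
have a2 : a ^+ 2 = 1 - b ^+ 2 by rewrite -k0; ring.
have a'2 : a' ^+ 2 = 1 - b' ^+ 2 by rewrite -k1; ring.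
by rewrite /reflect_in /double_angle /pdot /pdet /=; congr pair;
  rewrite /cmul /=; ring: a2 a'2.
Qed.

Lemma intersecting_lines k0 k1 h0 h1 : pdet k0 k1 != 0 ->
  exists c, pdot k0 c = h0 /\ pdot k1 c = h1.
Proof.
case: k0 k1 => [a b] [a' b']; rewrite /pdet /= => d0.
exists ((h0 * b' - h1 * b) / (a * b' - b * a'),
        (h1 * a - h0 * a') / (a * b' - b * a')).
by rewrite /pdot /=; split; field.
Qed.

Lemma cmul_eq0 w z : cmul w z = 0 -> w = 0 \/ z = 0.
Proof.
case: w z => [a b] [x y] [/= e1 e2].
have : (a ^+ 2 + b ^+ 2) * (x ^+ 2 + y ^+ 2) = 0.
  rewrite (_ : _ * _ = (a * x - b * y) ^+ 2 + (b * x + a * y) ^+ 2); last by ring.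
  by rewrite e1 e2; ring.
move/eqP; rewrite mulf_eq0 !paddr_eq0 ?sqr_ge0 // !sqrf_eq0.
by case/orP => /andP[/eqP-> /eqP->]; [left|right].
Qed.

Lemma parallel_units k l : pdot k k = 1 -> pdot l l = 1 -> pdet k l = 0 ->
  exists2 s, s ^+ 2 = 1 & l = (s * k.1, s * k.2).
Proof.
case: k l => [a b] [a' b']; rewrite /pdot /pdet /= => k1 l1 d0.
have a2 : a ^+ 2 = 1 - b ^+ 2 by rewrite -k1; ring.
have a'2 : a' ^+ 2 = 1 - b' ^+ 2 by rewrite -l1; ring.
exists (a * a' + b * b').
  have -> : (a * a' + b * b') ^+ 2 =
      (a * a + b * b) * (a' * a' + b' * b') - (a * b' - b * a') ^+ 2 by ring.
  by rewrite k1 l1 d0; ring.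
have -> : (a * a' + b * b') * a = a' + b * (a * b' - b * a') by ring: a2.
have -> : (a * a' + b * b') * b = b' - a * (a * b' - b * a') by ring: a2.
by rewrite d0; congr pair; ring.
Qed.

Lemma reflect_parallel k s h h' : s ^+ 2 = 1 -> pdot k k = 1 ->
  reflect_in (s * k.1, s * k.2) h' (reflect_in k h 0) =
  (2 * (s * h' - h) * k.1, 2 * (s * h' - h) * k.2).
Proof.
case: k => a b; rewrite /reflect_in /pdot /= => s2 k1.
have -> : 0 - 2 * (a * 0 + b * 0 - h) * a = 2 * h * a by ring.
have -> : 0 - 2 * (a * 0 + b * 0 - h) * b = 2 * h * b by ring.
have -> : s * a * (2 * h * a) + s * b * (2 * h * b) = 2 * s * h.
  by transitivity (2 * s * h * (a * a + b * b)); [ring|rewrite k1 mulr1].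
by congr pair; ring: s2.
Qed.

(** Two products of two reflections that agree at two points are direct isometries,
    hence equal.  Equal rotations have the same centre, which lies on all four
    lines.  Equal translations are orthogonal to both pairs of parallel lines; so
    either the two directions agree, or the translation vanishes, each pair
    consists of one line taken twice, and the two lines intersect. *)
Lemma four_reflections k0 k1 k2 k3 h0 h1 h2 h3 z z' :
    pdot k0 k0 = 1 -> pdot k1 k1 = 1 -> pdot k2 k2 = 1 -> pdot k3 k3 = 1 ->
    z <> z' ->
    (forall t, t = z \/ t = z' ->
       reflect_in k1 h1 (reflect_in k0 h0 t) =
       reflect_in k2 h2 (reflect_in k3 h3 t)) ->
  (exists c, [/\ pdot k0 c = h0, pdot k1 c = h1, pdot k2 c = h2 & pdot k3 c = h3])
  \/ [/\ pdet k0 k1 = 0, pdet k0 k2 = 0 & pdet k0 k3 = 0].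
Proof.
move=> u0 u1 u2 u3 zz' H.
pose T := reflect_in k1 h1 (reflect_in k0 h0 0).
pose T' := reflect_in k2 h2 (reflect_in k3 h3 0).
have E t : t = z \/ t = z' ->
    cmul (double_angle k0 k1) t + T = cmul (double_angle k3 k2) t + T'.
  by move=> /H; rewrite reflect2E // (reflect2E h3 h2).
have /cmul_eq0[Ew|] : cmul (double_angle k0 k1 - double_angle k3 k2) (z - z') = 0.
- have := E z (or_introl erefl); have := E z' (or_intror erefl).
  case: (z) (z') => [x y] [x' y']; case: (T) (T') => [t s] [t' s'].
  case: (double_angle _ _) (double_angle _ _) => [a b] [a' b'] [/= e1 e2] [/= e3 e4].
  by congr pair => /=; lra.
- move/eqP: Ew; rewrite subr_eq0 => /eqP Ew.
  (* The linear parts agree; now compare the translation parts. *)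
  have ET : T = T'.
    have := E z (or_introl erefl); rewrite Ew; exact: addrI.
  have [d0|d0] := eqVneq (pdet k0 k1) 0; last first.
    have d2 : pdet k3 k2 != 0.
      apply: contra_neq d0 => e; case: Ew => + _; rewrite e => e'.
      by apply/eqP; rewrite -sqrf_eq0; apply/eqP; lra.
    have [c [c0 c1]] := intersecting_lines h0 h1 d0.
    have [c' [c3 c2]] := intersecting_lines h3 h2 d2.
    left; exists c.
    have fixS k h t : pdot k t = h -> reflect_in k h t = t.
      by case: k t => [a b] [x y] <-; rewrite /reflect_in subrr mulr0 !mul0r !subr0.
    have Ec : cmul (double_angle k0 k1) c + T = c.
      by rewrite -reflect2E // !fixS // fixS.
    have Ec' : cmul (double_angle k3 k2) c' + T' = c'.
      by rewrite -reflect2E // !fixS // fixS.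
    have /cmul_eq0[] : cmul ((1, 0) - double_angle k0 k1) (c - c') = 0.
    - move: Ec Ec'; rewrite -Ew -ET.
      case: (c) (c') (T) (double_angle k0 k1) => [x y] [x' y'] [t s] [a b] [/= e1 e2] [/= e3 e4].
      by congr pair => /=; lra.
    - case=> e _; case/eqP: d0; apply/eqP; rewrite -sqrf_eq0; apply/eqP.
      by move: e; rewrite /=; lra.
    by move/eqP; rewrite subr_eq0 => /eqP ecc'; subst c'.
  have d2 : pdet k3 k2 = 0.
    case: Ew => + _; rewrite d0 => e'.
    by apply/eqP; rewrite -sqrf_eq0; apply/eqP; lra.
  have [d1|d1] := eqVneq (pdet k0 k3) 0.
    right; split => //; have [s s2 e3] := parallel_units u0 u3 d1.
    have s0 : s != 0 by rewrite -sqrf_eq0 s2 oner_eq0.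
    apply: (mulfI s0); rewrite mulr0 -d2 e3 /pdet /=; ring.
  left.
  have [c [c0 c3]] := intersecting_lines h0 h3 d1.
  have [s s2 e1] := parallel_units u0 u1 d0.
  have [s' s'2 e2] := parallel_units u3 u2 d2.
  exists c; move: ET; rewrite /T /T' e1 e2.
  rewrite (reflect_parallel _ _ s2 u0) (reflect_parallel _ _ s'2 u3).
  move: d1 c0 c3; case: (k0) (k3) (c) => [a b] [a' b'] [x y].
  rewrite /pdot /pdet /= => d1 c0 c3 [ea eb].
  have /eqP : (s * h1 - h0) * (a * b' - b * a') = 0.
    transitivity ((2 * (s * h1 - h0) * a * b' - 2 * (s * h1 - h0) * b * a') / 2).
      by field.
    by rewrite ea eb; ring.
  rewrite mulf_eq0 (negPf d1) orbF subr_eq0 => /eqP e01.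
  have /eqP : (s' * h2 - h3) * (a * b' - b * a') = 0.
    transitivity ((a * (2 * (s' * h2 - h3) * b') - b * (2 * (s' * h2 - h3) * a')) / 2).
      by field.
    by rewrite -ea -eb; ring.
  rewrite mulf_eq0 (negPf d1) orbF subr_eq0 => /eqP e32.
  split=> //; first by rewrite -!mulrA -mulrDr c0 -e01 mulrA -expr2 s2 mul1r.
  by rewrite -!mulrA -mulrDr c3 -e32 mulrA -expr2 s'2 mul1r.
- by move/eqP; rewrite subr_eq0 => /eqP.
Qed.
End PlaneReflections.

(** * Lines and plane reflections in space *)

Section Lines.
Variable R : realType.
Implicit Types (n k d x y K : 'rV[R]_3) (l : line R).

Definition plane_reflect k (h : R) y := y - (2 * (dot y k - h)) *: k.

(** Sums of units, and not numerals, because they match the successors i + 1 in the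
    cyclic hypotheses. *)
Lemma Z4P (i : 'Z_4) : i = 0 \/ i = 0 + 1 \/ i = 0 + 1 + 1 \/ i = 0 + 1 + 1 + 1.
Proof.
case: i => [[|[|[|[|//]]]] i4]; [left|right; left|right; right; left|do 3 right];
  exact/val_inj.
Qed.

(** The spatial form of [four_reflections]: planes parallel to n project along n to
    lines.  The chains M and M' project to two different points by the last
    hypothesis. *)
Lemma four_plane_reflections n (k : 'Z_4 -> 'rV[R]_3) (h : 'Z_4 -> R)
    (M M' : 'Z_4 -> 'rV[R]_3) :
    dot n n = 1 -> (forall i, dot (k i) (k i) = 1) ->
    (forall i, dot (k i) n = 0) ->
    (forall i, M (i + 1) = plane_reflect (k i) (h i) (M i)) ->
    (forall i, M' (i + 1) = plane_reflect (k i) (h i) (M' i)) ->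
    (forall c, M 0 - M' 0 <> c *: n) ->
  (exists c, forall i, dot c (k i) = h i) \/
  (forall i, k i = dot (k 0) (k i) *: k 0).
Proof.
move=> n1 k1 kn hM hM' nM.
pose e1 := k 0; pose e2 := cross n e1.
have co := planar_coordinates n1 (k1 0) (kn 0).
rewrite -/e1 -/e2 in co.
pose z x := (dot x e1, dot x e2).
have zk x i : dot x (k i) = pdot (z (k i)) (z x).
  by rewrite {1}(co _ (kn i)) /pdot /= dotDr !dotZr.
have zr i x : z (plane_reflect (k i) (h i) x) = reflect_in (z (k i)) (h i) (z x).
  by rewrite /plane_reflect /reflect_in -zk /z !(dotDl, dotNl, dotZl).
have zz i : pdot (z (k i)) (z (k i)) = 1 by rewrite -zk.
have cyc : (0 + 1 + 1 + 1 + 1 : 'Z_4) = 0 by apply/val_inj.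
(* The cyclic chain closes up: two steps forward and two steps backward from the
   index 0 lead to the same point. *)
have I3 (N : 'Z_4 -> 'rV_3) :
    (forall i, N (i + 1) = plane_reflect (k i) (h i) (N i)) ->
    reflect_in (z (k (0 + 1))) (h (0 + 1)) (reflect_in (z (k 0)) (h 0) (z (N 0))) =
    reflect_in (z (k (0 + 1 + 1))) (h (0 + 1 + 1))
      (reflect_in (z (k (0 + 1 + 1 + 1))) (h (0 + 1 + 1 + 1)) (z (N 0))).
  move=> hN; have zN i : reflect_in (z (k i)) (h i) (z (N i)) = z (N (i + 1)).
    by rewrite -zr hN.
  have -> : reflect_in (z (k (0 + 1 + 1 + 1))) (h (0 + 1 + 1 + 1)) (z (N 0)) =
      z (N (0 + 1 + 1 + 1)).
    by have := zN (0 + 1 + 1 + 1); rewrite cyc => <-; rewrite reflect_inK.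
  by rewrite !zN -[in RHS]zN reflect_inK.
have [||[c [c0 c1 c2 c3]]|[d1 d2 d3]] := four_reflections (zz 0) (zz (0+1))
    (zz (0+1+1)) (zz (0+1+1+1)) (z := z (M 0)) (z' := z (M' 0))
    (h0 := h 0) (h1 := h (0+1)) (h2 := h (0+1+1)) (h3 := h (0+1+1+1)).
- move=> ezz; pose y := M 0 - M' 0.
  apply: (nM (dot y n)); rewrite -/y.
  have y0 : dot (y - dot y n *: n) n = 0 by rewrite dotDl dotNl dotZl n1; ring.
  have [ey1 ey2] : dot y e1 = 0 /\ dot y e2 = 0.
    by case: ezz => E1 E2; rewrite /y !(dotDl, dotNl) E1 E2 !subrr.
  clearbody y; apply/eqP; rewrite -subr_eq0 (co _ y0) !(dotDl, dotNl, dotZl) ey1 ey2.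
  by rewrite (dotC n e1) kn (dotC n e2) dot_crossl !mulr0 !subr0 !scale0r addr0.
- by move=> t [->|->]; exact: I3.
- left; exists (c.1 *: e1 + c.2 *: e2) => i.
  have zc : z (c.1 *: e1 + c.2 *: e2) = c.
    rewrite /z !dotDl !dotZl k1 (dotC e1 e2) dot_crossr dot_cross_cross n1 k1.
    rewrite (dotC n) kn expr0n subr0 !mulr1 !mulr0 addr0 add0r.
    by case: (c).
  by rewrite zk zc; have [->|[->|[->|->]]] := Z4P i.
- right => i; have e12 : dot (k i) e2 = 0.
    have z0 : z (k 0) = (1, 0) by rewrite /z k1 (dotC _ e2) dot_crossr.
    have ze x : dot x e2 = pdet (z (k 0)) (z x) by rewrite z0 /pdet /=; ring.
    rewrite ze; have [->|[->|[->|->]]] := Z4P i => //.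
    by rewrite /pdet; ring.
  by rewrite {1}(co _ (kn i)) e12 scale0r addr0 dotC.
Qed.

Lemma in_span n d k x : dot n n = 1 -> dot k k = 1 -> dot k n = 0 ->
  dot k d = 0 -> (forall c, d <> c *: n) -> dot x k = 0 ->
  exists s t, x = s *: n + t *: d.
Proof.
move=> n1 k1 kn kd nd xk.
have co y : dot y k = 0 -> y = dot y n *: n + dot y (cross n k) *: cross n k.
  move=> yk; rewrite -[LHS](subrK (dot y n *: n)).
  rewrite [y - _](planar_coordinates n1 k1 kn); last by rewrite dotDl dotNl dotZl n1; ring.
  rewrite !(dotDl, dotNl, dotZl) yk (dotC n k) kn (dotC n (cross n k)) dot_crossl.
  by rewrite !mulr0 !subr0 scale0r add0r addrC.
have dk : dot d k = 0 by rewrite dotC.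
have [d0|d0] := eqVneq (dot d (cross n k)) 0.
  by case: (nd (dot d n)); rewrite {1}(co d dk) d0 scale0r addr0.
pose t := dot x (cross n k) / dot d (cross n k).
exists (dot x n - t * dot d n), t.
rewrite [X in _ + t *: X](co d dk) scalerDr !scalerA divfK // addrA -scalerDl.
by rewrite subrK -co.
Qed.

(** A line that is not orthogonal to K can be parametrized by the height over K;
    then points at equal heights on different lines can be compared. *)
Lemma level_form l K : dot (ldir l) K != 0 ->
  exists o g, [/\ dot o K = 0, dot g K = 1 &
    forall x, lpoints l x <-> x = o + dot x K *: g].
Proof.
move=> lK; pose g := (dot (ldir l) K)^-1 *: ldir l.
have gK : dot g K = 1 by rewrite dotZl mulVf.
have lg : ldir l = dot (ldir l) K *: g by rewrite scalerA divff // scale1r.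
exists (lpt l - dot (lpt l) K *: g), g; split=> //.
  by rewrite dotDl dotNl dotZl gK; ring.
move=> x; split.
  by case=> s ->; rewrite dotDl dotZl scalerDl addrA subrK -scalerA -lg.
move=> ->; exists ((dot x K - dot (lpt l) K) / dot (ldir l) K).
by rewrite -scalerA -/g scalerBl addrA addrAC.
Qed.

End Lines.

(** * Consequences of having precisely two transversals *)

Section Transversals.
Variable R : realType.
Implicit Types (n k d x y K : 'rV[R]_3) (l : line R).
Variables (r : 'Z_4 -> line R) (u v : line R).
Hypothesis huv : precisely_two_transversals r u v.

(** Every line through a common point of the axes would be a transversal; three
    such lines already suffice for a contradiction. *)
Lemma two_transversals_not_concurrent x : ~ forall i, lpoints (r i) x.
Proof.
move=> hx.
have e0 j : delta_mx 0 j != 0 :> 'rV[R]_3.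
  by apply/eqP => /rowP/(_ j)/eqP; rewrite !mxE !eqxx oner_eq0.
pose L j := Line x (e0 j).
have LL j j' : j != j' -> lpoints (L j) <> lpoints (L j').
  move=> jj' E; have : lpoints (L j) (x + delta_mx 0 j) by exists 1; rewrite scale1r.
  rewrite E => -[s] /addrI /rowP/(_ j)/eqP.
  by rewrite !mxE !eqxx (negPf jj') mulr0 oner_eq0.
have TL j : Defs.transversal r (L j).
  by move=> i; exists x; split=> //; exists 0; rewrite scale0r addr0.
case: huv => _ H.
have ne3 (j j' : 'I_3) : j != j' -> lpoints (L j) = lpoints (L j') -> False.
  by move=> /LL.
case: ((H _).1 (TL 0)) => E0; case: ((H _).1 (TL 1)) => E1;
  case: ((H _).1 (TL 2)) => E2;
first [exact: (ne3 0 1 isT (etrans E0 (esym E1)))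
      |exact: (ne3 0 2 isT (etrans E0 (esym E2)))
      |exact: (ne3 1 2 isT (etrans E1 (esym E2)))].
Qed.

(** Suppose that the axes lie in planes orthogonal to K that are not all equal.
    Then every transversal crosses these planes and can be parametrized by the
    height over K.  The midpoints of the points of u and v at equal heights form
    another line, which meets all axes because it does so at their heights. *)
Lemma two_transversals_level K : (forall i, dot (ldir (r i)) K = 0) ->
  forall i j, dot (lpt (r i)) K = dot (lpt (r j)) K.
Proof.
move=> dK i j; apply/eqP/negPn/negP => /eqP Hij.
case: huv => uv H.
have tu : Defs.transversal r u by apply/H; left.
have tv : Defs.transversal r v by apply/H; right.
have hgt m x : lpoints (r m) x -> dot x K = dot (lpt (r m)) K.
  by case=> s ->; rewrite dotDl dotZl dK mulr0 addr0.
have form l : Defs.transversal r l -> exists o g, [/\ dot o K = 0, dot g K = 1,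
    (forall x, lpoints l x <-> x = o + dot x K *: g) &
    forall m, lpoints (r m) (o + dot (lpt (r m)) K *: g)].
  move=> tl; have lK : dot (ldir l) K != 0.
    apply/eqP => l0; apply: Hij.
    have [y [[s ys] /hgt<-]] := tl i; have [y' [[s' ys'] /hgt<-]] := tl j.
    by rewrite ys ys' !(dotDl, dotZl) l0 !mulr0.
  have [o [g [o0 g1 hog]]] := level_form lK.
  exists o, g; split=> // m.
  by have [y [/hog yl yr]] := tl m; rewrite -(hgt _ _ yr) -yl.
have [o [g [oK gK fu ru]]] := form u tu.
have [o' [g' [o'K g'K fv rv]]] := form v tv.
pose o2 := 2^-1 *: (o + o'); pose g2 := 2^-1 *: (g + g').
have o2K : dot o2 K = 0 by rewrite !(dotDl, dotZl) oK o'K; ring.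
have g2K : dot g2 K = 1 by rewrite !(dotDl, dotZl) gK g'K; field.
have g20 : g2 != 0 by apply: contra_eq_neq g2K => ->; rewrite dot0l eq_sym oner_eq0.
pose w := Line o2 g20.
have wpt h : lpoints w (o2 + h *: g2) by exists h.
have htw h : dot (o2 + h *: g2) K = h by rewrite dotDl (dotZl h) o2K g2K; ring.
have tw : Defs.transversal r w.
  move=> m; exists (o2 + dot (lpt (r m)) K *: g2); split=> //.
  have [[s es] [s' es']] := (ru m, rv m).
  exists (2^-1 * (s + s')).
  have -> : o2 + dot (lpt (r m)) K *: g2 = 2^-1 *:
     ((o + dot (lpt (r m)) K *: g) + (o' + dot (lpt (r m)) K *: g')).
    by apply/rowP => a; rewrite !mxE; ring.
  by rewrite es es'; apply/rowP => a; rewrite !mxE; field.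
(* A line that agrees with the midline at every height agrees with the other
   transversal as well. *)
have same (p q p' q' : 'rV[R]_3) :
   (forall h, 2^-1 *: (p + p') + h *: (2^-1 *: (q + q')) = p + h *: q) ->
    p = p' /\ q = q'.
  move=> E; have ep : p = p'.
    have := E 0; rewrite !scale0r !addr0 => /(congr1 ( *:%R 2)).
    by rewrite scalerA divff ?pnatr_eq0 // scale1r scaler_nat mulr2n => /addrI.
  split=> //; have := E 1; rewrite -ep !scale1r.
  move=> /(congr1 ( *:%R 2)); rewrite !scalerDr !scalerA divff ?pnatr_eq0 //.
  by rewrite !scale1r !scaler_nat !mulr2n => /addrI/addrI.
have eq_uv : o = o' /\ g = g' -> False.
  case=> eo eg; apply: uv; apply/seteqP; split=> x; first by move/fu; rewrite eo eg => /fv.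
  by move/fv; rewrite -eo -eg => /fu.
apply: eq_uv; case/H: tw => E.
  by apply: same => h; move: (wpt h); rewrite E => /fu; rewrite htw.
suff [-> ->] : o' = o /\ g' = g by [].
apply: same => h; rewrite (addrC o') (addrC g').
by move: (wpt h); rewrite E => /fv; rewrite htw.
Qed.
End Transversals.

(** * Oriented contact with a cone of revolution *)

Section Cone.
Variable R : realType.

(** By dimension, the column space of N consists of all vectors that are orthogonal
    to w. *)
Lemma rank3_solvable (N : 'M[R]_(4, 3)) (w : 'rV_4) (y : 'cV_4) :
  \rank N = 3 -> w != 0 -> w *m N = 0 -> w *m y = 0 ->
  exists x : 'rV_3, N *m x^T = y.
Proof.
move=> rN w0 wN wy.
have sN : (N^T <= kermx w^T)%MS by apply/sub_kermxP; rewrite -trmx_mul wN trmx0.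
have rw : \rank w = 1%N by rewrite rank_rV w0.
have sy : (y^T <= N^T)%MS.
  have /eqmxP -> : (N^T == kermx w^T)%MS.
    by rewrite -(mxrank_leqif_eq sN).2 mxrank_ker !mxrank_tr rN rw.
  by apply/sub_kermxP; rewrite -trmx_mul wy trmx0.
case/submxP: sy => D /(congr1 trmx); rewrite trmxK trmx_mul trmxK => ->.
by exists D.
Qed.

Lemma normal_mxE (e : 'Z_4 -> oplane R) (x : 'rV[R]_3) i :
  ((\matrix_(i < 4) onormal (e i)) *m x^T) i 0 = dot (onormal (e i)) x.
Proof. by rewrite dotE mxE; apply: eq_bigr => j _; rewrite !mxE. Qed.

Lemma normals_span_not_constant (e : 'Z_4 -> oplane R) m : normals_span e ->
  ~ forall i, onormal (e i) = m.
Proof.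
rewrite /normals_span; set N := (X in \rank X) => rk nm.
have : (\rank N <= 1)%N.
  have -> : N = const_mx 1 *m m.
    by apply/matrixP => i j; rewrite !mxE big_ord1 !mxE nm mul1r.
  by apply: leq_trans (mxrankM_maxr _ _) _; rewrite rank_leq_row.
by rewrite rk.
Qed.

(** Since the normals have rank three, the relation w is the only obstruction to
    solving linear systems whose rows are the normals.  The solution x for the
    offsets is the apex; the solution a for the constant 1 is orthogonal to the
    plane of the circle. *)
Lemma cone_of_relation (e : 'Z_4 -> oplane R) (w : 'Z_4 -> R) :
  normals_span e -> (exists i, w i != 0) ->
  \sum_i w i *: onormal (e i) = 0 -> \sum_i w i = 0 ->
  \sum_i w i * ooffset (e i) = 0 ->
  tangent_to_cone e.
Proof.
move=> rk [i0 wi0] wn w1 wo.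
pose N := \matrix_(i < 4) onormal (e i).
pose W : 'rV[R]_4 := \row_i w i.
have W0 : W != 0 by apply: contra_neq wi0 => /rowP/(_ i0); rewrite !mxE.
have WN : W *m N = 0.
  rewrite -wn mulmx_sum_row; apply: eq_bigr => i _.
  by rewrite rowK mxE.
have solve (y : 'Z_4 -> R) : \sum_i w i * y i = 0 ->
    exists x, forall i, dot (onormal (e i)) x = y i.
  move=> wy; have [|x Ex] := @rank3_solvable N W (\col_i y i) rk W0 WN.
    apply/matrixP => a b; rewrite !mxE -[RHS]wy; apply: eq_bigr => i _.
    by rewrite !mxE.
  by exists x => i; rewrite -normal_mxE Ex mxE.
have [|x hx] := solve (fun i => ooffset (e i)); first exact: wo.
have [|a ha] := solve (fun=> 1).
  by rewrite -[RHS]w1; apply: eq_bigr => i _; rewrite mulr1.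
split=> //; first by exists x.
have a0 : a != 0.
  apply/eqP => a0; have := ha 0; rewrite a0 dotC dot0l => /esym/eqP.
  by rewrite oner_eq0.
have aa : dot a a != 0 by rewrite dot_eq0.
(* The circle is cut out of the unit sphere by the plane of all z with a.z = 1,
   whose distance from the origin is 1 / |a|. *)
pose m := (dot a a)^-1 *: a.
pose rho2 := 1 - (dot a a)^-1.
have hrho i : dot (onormal (e i) - m) (onormal (e i) - m) = rho2.
  rewrite !(dotDl, dotDr, dotNl, dotNr, dotZl, dotZr) onormal_unit.
  by rewrite ha (dotC a) ha /rho2; field.
have rho_gt0 : 0 < rho2.
  rewrite lt_neqAle -{2}(hrho 0) dot_ge0 andbT; apply/eqP => r0.
  apply: (normals_span_not_constant (m := m) rk) => i.
  by apply/eqP; rewrite -subr_eq0 -dot_eq0 hrho -r0.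
exists m, a, (Num.sqrt rho2); split=> //; first by rewrite sqrtr_gt0.
move=> i; split; last by rewrite hrho sqr_sqrtr // ltW.
by rewrite dotDr dotNr dotC ha dotZr mulVf // subrr.
Qed.

(** The plane of the circle avoids the origin, because the normals span space; so
    its normal vector a can be scaled to make the products equal to 1.  If a were
    itself one of the unit normals, the circle would shrink to a point. *)
Lemma cone_axis (e : 'Z_4 -> oplane R) : tangent_to_cone e ->
  exists a, (forall i, dot (onormal (e i)) a = 1) /\ forall i, onormal (e i) <> a.
Proof.
case=> _ [m [a [rho [a0 rho0 circ]]]] rk.
have am i : dot (onormal (e i)) a = dot a m.
  by have [/eqP + _] := circ i; rewrite dotDr dotNr subr_eq0 dotC => /eqP.
pose N := \matrix_(i < 4) onormal (e i).
have c0 : dot a m != 0.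
  apply: contra_neq a0 => c0.
  have /row_freeP[B NB] : row_free N^T by rewrite /row_free mxrank_tr rk.
  have : a *m N^T = 0.
    apply/rowP => i; rewrite -[a *m _]trmxK trmx_mul trmxK mxE normal_mxE am c0.
    by rewrite mxE.
  by move/(congr1 (mulmx^~ B)); rewrite -mulmxA NB mulmx1 mul0mx.
exists ((dot a m)^-1 *: a); split=> [i|i0 Ei0].
  by rewrite dotZr am mulVf.
apply: (normals_span_not_constant (m := (dot a m)^-1 *: a) rk) => i.
apply/eqP; rewrite -subr_eq0 -dot_eq0 -Ei0.
have ni0 : dot (onormal (e i)) (onormal (e i0)) = 1 by rewrite Ei0 dotZr am mulVf.
rewrite !(dotDl, dotDr, dotNl, dotNr) !onormal_unit (dotC (onormal (e i0))) ni0.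
by apply/eqP; ring.
Qed.
End Cone.

(** * The locus of planes *)

Section Locus.
Variables (R : realType) (alpha : 'Z_4 -> displacement R) (r : 'Z_4 -> line R).
Hypothesis hr : forall i, relative_revolute_axis alpha i (r i).

Lemma axisP i x : alpha i x = alpha (i + 1) x <-> lpoints (r i) x.
Proof. by rewrite hr. Qed.

Lemma axis_dir i : ldir (r i) *m drot (alpha i) = ldir (r i) *m drot (alpha (i + 1)).
Proof.
have /axisP E1 : lpoints (r i) (lpt (r i)) by exists 0; rewrite scale0r addr0.
have /axisP E2 : lpoints (r i) (lpt (r i) + ldir (r i)) by exists 1; rewrite scale1r.
move: E2; rewrite /dapp !mulmxDl addrAC [RHS]addrAC.
by move: E1; rewrite /dapp => ->; move/addrI.
Qed.

(** Trades the translation part of alpha_i for the image of a point y, to be chosen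
    on an axis, where two consecutive displacements agree. *)
Lemma offset_homologous e i y : ooffset (homologous alpha e i) =
  ooffset e + dot (onormal (homologous alpha e i)) (alpha i y) - dot (onormal e) y.
Proof.
by rewrite /= /dapp dotDr dot_drot; ring.
Qed.

(** Two consecutive image planes coincide, because they share their normal and the
    axis meets both in the same point; the relation says just that. *)
Lemma revolute_cone i0 e : orthogonal_pencil (r i0) e ->
  normals_span (homologous alpha e) -> tangent_to_cone (homologous alpha e).
Proof.
case=> c nc rk; pose i1 := i0 + 1.
have i01 : i0 != i1.
  by rewrite eq_sym -subr_eq0 addrAC subrr add0r oner_eq0.
pose w (i : 'Z_4) : R := (i == i0)%:R - (i == i1)%:R.
have wR (f : 'Z_4 -> R) : \sum_i w i * f i = f i0 - f i1.
  rewrite (bigD1 i0) //= (bigD1 i1) 1?eq_sym //= big1 => [|i /andP[/negPf a /negPf b]].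
    by rewrite /w !eqxx (eq_sym i1) (negPf i01) /=; ring.
  by rewrite /w a b subrr mul0r.
have En : onormal (homologous alpha e i0) = onormal (homologous alpha e i1).
  by rewrite /= nc -!scalemxAl axis_dir.
apply: (cone_of_relation (w := w)) => //.
- by exists i0; rewrite /w eqxx (negPf i01) subr0 oner_eq0.
- apply/rowP => j; rewrite summxE mxE.
  transitivity (\sum_i w i * onormal (homologous alpha e i) 0 j).
    by apply: eq_bigr => i _; rewrite mxE.
  by rewrite wR En subrr.
- transitivity (\sum_i w i * 1); first by apply: eq_bigr => i _; rewrite mulr1.
  by rewrite wR subrr.
rewrite wR !(offset_homologous _ _ (lpt (r i0))) En.
have /axisP -> : lpoints (r i0) (lpt (r i0)) by exists 0; rewrite scale0r addr0.
by rewrite subrr.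
Qed.

Lemma shift_sum (V : nmodType) (f : 'Z_4 -> V) : \sum_i f (i + 1) = \sum_i f i.
Proof. by rewrite [RHS](reindex_inj (addIr 1)). Qed.

(** The closed quadrilateral P_0 P_1 P_2 P_3, whose sides have the directions of the
    image normals, provides the relation. *)
Lemma transversal_cone l e : Defs.transversal r l ->
  (forall x, ~ forall i, lpoints (r i) x) ->
  orthogonal_pencil l e ->
  normals_span (homologous alpha e) -> tangent_to_cone (homologous alpha e).
Proof.
move=> tl nconc [c nc] rk; pose n := onormal e.
have c0 : c != 0.
  apply/eqP => c0; have := onormal_unit e; rewrite nc c0 scale0r dot0l => /esym/eqP.
  by rewrite oner_eq0.
have /fin_all_exists[s hs] i : exists s, lpoints (r i) (lpt l + s *: n).
  have [x [[s xs] xr]] := tl i; exists (s / c).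
  by rewrite /n nc scalerA divfK // -xs.
pose X i := lpt l + s i *: n.
pose P i := alpha i (X i).
have P1 i : P i = alpha (i + 1) (X i) by apply/axisP/hs.
pose w i := s i - s (i - 1).
have w1 i : w (i + 1) = s (i + 1) - s i by rewrite /w addrK.
have Xw i : X (i + 1) - X i = w (i + 1) *: n.
  by rewrite w1 /X scalerBl opprD addrACA subrr add0r.
have Pw i : w (i + 1) *: onormal (homologous alpha e (i + 1)) = P (i + 1) - P i.
  by rewrite (P1 i) /= /P /dapp opprD addrACA subrr addr0 -mulmxBl Xw scalemxAl.
have sw : \sum_i w i = 0.
  rewrite -shift_sum (eq_bigr _ (fun i _ => w1 i)) sumrB.
  by rewrite (shift_sum s) subrr.
apply: (cone_of_relation (w := w)) => //.
- apply: contrapT => nw; apply: (nconc (X 0)) => i.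
  have sc j : s (j + 1) = s j.
    apply/eqP; rewrite -subr_eq0 -w1; apply/negPn/negP => h.
    by apply: nw; exists (j + 1).
  rewrite /X; have -> : s 0 = s i; last exact: hs.
  by have [->|[->|[->|->]]] := Z4P i; rewrite ?sc.
- rewrite -shift_sum (eq_bigr _ (fun i _ => Pw i)) sumrB.
  by rewrite (shift_sum P) subrr.
(* The offset can be computed from either end point of a side; averaging the two
   expressions gives a difference of squares, so that the sum telescopes. *)
pose G i := 2^-1 * (dot (P i) (P i)) - 2^-1 * (dot n (X i) ^+ 2).
have key i : w (i + 1) * ooffset (homologous alpha e (i + 1)) =
    w (i + 1) * ooffset e + (G (i + 1) - G i).
  set W := w (i + 1); set O := ooffset _.
  have O1 : W * O = W * ooffset e + dot (P (i + 1) - P i) (P (i + 1)) -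
      W * dot n (X (i + 1)).
    by rewrite -Pw dotZl /O (offset_homologous _ _ (X (i + 1))) /W /P; ring.
  have O2 : W * O = W * ooffset e + dot (P (i + 1) - P i) (P i) -
      W * dot n (X i).
    by rewrite -Pw dotZl /O (offset_homologous _ _ (X i)) P1 /W; ring.
  have WX : W = dot n (X (i + 1)) - dot n (X i).
    by rewrite -dotNr -dotDr Xw dotZr onormal_unit mulr1.
  transitivity (2^-1 * (W * O) + 2^-1 * (W * O)); first by field.
  rewrite {1}O1 O2 /G; move: (P i) (P (i + 1)) WX => p p' ->.
  by rewrite !(dotDl, dotNl) (dotC p p'); field.
rewrite -shift_sum (eq_bigr _ (fun i _ => key i)) big_split sumrB /=.
by rewrite (shift_sum G) subrr addr0 (shift_sum (fun i => w i * _)) -mulr_suml sw mul0r.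
Qed.

(** Both M and M' have the distances of Q from the common image of the axis, so
    M' - M is orthogonal to the axis and to n, and M and M' are equidistant from
    the plane through the axis with normal k.  Equal points need an argument of their own: a point
    with alpha_i (M) = alpha_(i+1) (M) lies on the axis, hence in that plane. *)
Lemma reflect_pullback i n k (Q : 'rV[R]_3) M M' :
  alpha i M = Q -> alpha (i + 1) M' = Q -> dot M n = dot M' n ->
  dot k k = 1 -> dot k (ldir (r i)) = 0 ->
  (forall x, dot x n = 0 -> dot x (ldir (r i)) = 0 -> x = dot x k *: k) ->
  M' = plane_reflect k (dot (lpt (r i)) k) M.
Proof.
move=> MQ MQ' MM' k1 kd span; set p := lpt (r i); set d := ldir (r i).
have /axisP pp : lpoints (r i) p by exists 0; rewrite scale0r addr0.
have Mp : Q - alpha i p = (M - p) *m drot (alpha i).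
  by rewrite -MQ /dapp opprD addrACA subrr addr0 mulmxBl.
have M'p : Q - alpha i p = (M' - p) *m drot (alpha (i + 1)).
  by rewrite pp -MQ' /dapp opprD addrACA subrr addr0 mulmxBl.
have Md : dot (M - p) d = dot (M' - p) d.
  by rewrite -(dot_drot (alpha i)) -(dot_drot (alpha (i + 1)) (M' - p)) -Mp -M'p axis_dir.
have MM : dot (M - p) (M - p) = dot (M' - p) (M' - p).
  by rewrite -(dot_drot (alpha i)) -(dot_drot (alpha (i + 1)) (M' - p)) -Mp -M'p.
pose lam := dot (M' - M) k.
have ED : M' - M = lam *: k.
  apply: span; first by rewrite dotDl dotNl MM' subrr.
  by move: Md; rewrite !(dotDl, dotNl) => /addIr ->; rewrite subrr.
have EM' : M' = M + lam *: k by rewrite -ED addrC subrK.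
have : lam * (lam + 2 * dot (M - p) k) = 0.
  move: MM; rewrite EM' addrAC; move: (M - p) => D.
  by rewrite !(dotDl, dotDr, dotZl, dotZr) k1 (dotC k) => E; lra.
move/eqP; rewrite mulf_eq0 => /orP[/eqP l0|/eqP l0].
  have MM1 : M' = M by rewrite EM' l0 scale0r addr0.
  have /axisP[s Ms] : alpha i M = alpha (i + 1) M by rewrite MQ -MQ' MM1.
  rewrite /plane_reflect MM1 [X in dot X k]Ms dotDl dotZl (dotC d) kd.
  by rewrite mulr0 addr0 subrr mulr0 scale0r subr0.
rewrite /plane_reflect EM'; congr (_ + _); rewrite -scaleNr; congr (_ *: _).
by move: l0; rewrite dotDl dotNl; lra.
Qed.

(** The points M t i are the preimages of the point with parameter t on the cone
    axis; the parameters 0 and 1 provide the two chains of reflections. *)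
Lemma cone_pencil u v e : precisely_two_transversals r u v ->
  tangent_to_cone (homologous alpha e) -> six_pencils r u v e.
Proof.
move=> huv te; apply: contrapT => nsix; pose n := onormal e.
have n1 : dot n n = 1 := onormal_unit e.
have nd i c : n != c *: ldir (r i).
  by apply/eqP => E; apply: nsix; left; exists i => //; exists c.
have dn i c : ldir (r i) <> c *: n.
  move=> E; have c0 : c != 0.
    by apply: contra_neq (ldir_neq0 (r i)) => c0; rewrite E c0 scale0r.
  by case/eqP: (nd i c^-1); rewrite E scalerA mulVf // scale1r.
have ntr l : Defs.transversal r l -> (exists c, n = c *: ldir l) -> False.
  move=> tl [c nc]; apply: nsix; right.
  have [m [mm mt]] : exists m, (m = u \/ m = v) /\ lpoints l = lpoints m.
    by case: huv => _ /(_ l)[/(_ tl)[E|E] _]; [exists u|exists v]; split=> //; [left|right].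
  have [x0 x1] : lpoints m (lpt l) /\ lpoints m (lpt l + ldir l).
    by rewrite -mt; split; [exists 0; rewrite scale0r addr0|exists 1; rewrite scale1r].
  have {}nc : orthogonal_pencil m e.
    case: x0 x1 => s x0 [t]; rewrite x0 -addrA => /addrI/(canRL (addKr _)) El.
    by exists (c * (- s + t)); rewrite -/n nc El -scaleNr -scalerDl scalerA.
  by case: mm => <-; [left|right].
have /fin_all_exists[k hk] i := unit_common_normal n1 (nd i) (ldir_neq0 (r i)).
have [a [ha na]] := cone_axis te.
case: te => -[x hx] _ rk.
pose h i := dot (lpt (r i)) (k i).
pose M t i : 'rV[R]_3 := (x + t *: a - dtrans (alpha i)) *m (drot (alpha i))^T.
have RR i : (drot (alpha i))^T *m drot (alpha i) = 1%:M.
  by apply: mulmx1C; case: (drotP (alpha i)).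
have MQ t i : alpha i (M t i) = x + t *: a.
  by rewrite /dapp /M -mulmxA RR mulmx1 subrK.
have Mn t i : dot (M t i) n = ooffset e + t.
  rewrite dotC -(dot_drot (alpha i)) /M -mulmxA RR mulmx1.
  rewrite dotDr dotDr dotNr dotZr (ha i) mulr1.
  by have := hx i; rewrite /opoints /= => ->; ring.
have refl t i : M t (i + 1) = plane_reflect (k i) (h i) (M t i).
  have [k1 kn kd span] := hk i.
  by apply: (reflect_pullback (MQ t i) (MQ t (i + 1)) _ k1 kd span); rewrite !Mn.
(* Otherwise the cone axis would be orthogonal to the image planes and all image
   normals would be equal. *)
have MM c : M 1 0 - M 0 0 <> c *: n.
  move=> E; have Ea : a = c *: onormal (homologous alpha e 0).
    rewrite /= scalemxAl -E /M -mulmxBl -mulmxA RR mulmx1 scale1r scale0r addr0.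
    by rewrite opprD opprK addrACA addNr addr0 addrAC subrr add0r.
  apply: (na 0); rewrite Ea; have := ha 0; rewrite {1}Ea dotZr onormal_unit mulr1.
  by move=> ->; rewrite scale1r.
have k1 i : dot (k i) (k i) = 1 by case: (hk i).
have kn i : dot (k i) n = 0 by case: (hk i).
have kd i : dot (k i) (ldir (r i)) = 0 by case: (hk i).
(* A point c in all four planes B_i would give a transversal with direction n. *)
have noc c : ~ forall i, dot c (k i) = h i.
  move=> hc.
  have n0 : n != 0 by apply: contra_eq_neq n1 => ->; rewrite dot0l eq_sym oner_eq0.
  apply: (ntr (Line c n0)); last by exists 1; rewrite scale1r.
  move=> i.
  have [||s [t st]] := in_span (x := lpt (r i) - c) n1 (k1 i) (kn i) (kd i).
  - exact: dn.
  - by rewrite dotDl dotNl hc subrr.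
  exists (c + s *: n); split; first by exists s.
  by exists (- t); rewrite scaleNr -(subrK c (lpt _)) st addrAC addrK addrC.
have [[c hc]|par] := four_plane_reflections n1 k1 kn (refl 1) (refl 0) MM.
  exact: noc hc.
have kk0 i : dot (k 0) (k i) != 0.
  apply: contra_eq_neq (k1 i) => E; by rewrite {1}par E scale0r dot0l eq_sym oner_eq0.
have lev i : dot (ldir (r i)) (k 0) = 0.
  rewrite dotC; have := kd i; rewrite par dotZl => /eqP; rewrite mulf_eq0 (negPf (kk0 i)).
  by move/eqP.
(* The axes are at the same height over k 0, so the planes B_i coincide. *)
apply: (noc (dot (lpt (r 0)) (k 0) *: k 0)) => i.
rewrite dotZl /h [in RHS]par dotZr mulrC.
by rewrite (two_transversals_level huv lev 0 i).
Qed.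

End Locus.

Theorem theorem5 (R : realType) (alpha : 'Z_4 -> displacement R)
    (A : 'Z_4 -> 'rV[R]_(4 + 4)) (r : 'Z_4 -> line R) (u v : line R)
    (halpha : rotation_quadrangle alpha)
    (hA : forall i, study_image (A i) (alpha i))
    (hgen : study_generic A)
    (hr : forall i, relative_revolute_axis alpha i (r i))
    (huv : precisely_two_transversals r u v) :
  cone_locus alpha = six_pencils r u v `&` qualifying alpha /\
  (six_pencils r u v `<=` qualifying alpha ->
   cone_locus alpha = six_pencils r u v).
Proof.
have E : cone_locus alpha = six_pencils r u v `&` qualifying alpha.
  have nc := two_transversals_not_concurrent huv.
  have [_ H] := huv.
  apply/seteqP; split=> e.
    by move=> te; split; [apply: cone_pencil te|case: te].
  case=> -[[i _ ei]|[ei|ei]] q.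
  - exact: revolute_cone ei q.
  - by apply: transversal_cone nc ei q => //; apply/H; left.
  - by apply: transversal_cone nc ei q => //; apply/H; right.
by split=> // sub; rewrite E; apply/setIidl.
Qed.
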